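(* Let $n\ge 3$ be an integer. The cycle $C_n$ admits pretty good state transfer if and only if $n=2^k$ for some integer $k\ge 2$.
   Context: For a finite simple graph $G$ with adjacency matrix $A$, the transition matrix is $H(t)=\exp(-itA)$, $t\in\mathbb{R}$. For a vertex $u$, $e_u$ denotes the standard basis (column) vector indexed by $u$. The graph $G$ admits pretty good state transfer between two distinct vertices $u$ and $v$ if there exist a sequence of real numbers $\{t_k\}$ and a complex number $\gamma$ with $|\gamma|=1$ such that $\lim_{k\to\infty}H(t_k)e_u=\gamma e_v$. The graph $G$ admits pretty good state transfer if it does so between some pair of distinct vertices. The cycle $C_n$ ($n\ge 3$) is the graph with vertex set $\mathbb{Z}_n$ in which $a,b$ are adjacent if and only if $a-b\in\{1,n-1\}$. *)

(* Defs.v *)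
From HB Require Import structures.
From mathcomp Require Import all_boot all_order all_algebra.
From mathcomp Require Import complex.
From mathcomp Require Import all_classical all_reals all_analysis.

Set Implicit Arguments.
Unset Strict Implicit.
Unset Printing Implicit Defensive.

Import Order.TTheory GRing.Theory Num.Theory numFieldNormedType.Exports.
Local Open Scope classical_set_scope.
Local Open Scope ring_scope.

Record sgraph (V : finType) := SGraph {
  adj :> rel V;
  adj_sym : symmetric adj;
  adj_irrefl : irreflexive adj
}.

(* MathComp-Analysis equips every numClosedFieldType with the topology of its
   norm; naming R[i] at that type makes this topology available on it, and the
   corresponding entrywise topology on matrices over it. *)
Definition Cplx (R : realType) : numClosedFieldType := R[i].

(* limn is a total operator; the exponential series converges for every M. *)
Definition expmx (R : realType) (m : nat) (M : 'M[Cplx R]_m) : 'M[Cplx R]_m :=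
  limn (series (fun k : nat => (k`!%:R)^-1 *: M ^+ k)).

(* Rows and columns are indexed by V through its enumeration enum_val. *)
Definition adjmx (R : realType) (V : finType) (G : sgraph V) :
    'M[Cplx R]_#|V| :=
  \matrix_(i, j) (G (enum_val i) (enum_val j))%:R.

(* H(t) = exp(- i t A) *)
Definition transition (R : realType) (V : finType) (G : sgraph V) (t : R) :
    'M[Cplx R]_#|V| :=
  expmx ((- ('i%C * t%:C%C) : Cplx R) *: adjmx R G).

Definition vertex_vec (R : realType) (V : finType) (u : V) : 'cV[Cplx R]_#|V| :=
  delta_mx (enum_rank u) 0.

Definition pgst_between (R : realType) (V : finType) (G : sgraph V) (u v : V) :
    Prop :=
  u <> v /\
  exists (t : nat -> R) (gamma : Cplx R),
    `|gamma| = 1 /\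
    (fun k => transition G (t k) *m vertex_vec R u) @ \oo
      --> gamma *: vertex_vec R v.

Definition pgst (R : realType) (V : finType) (G : sgraph V) : Prop :=
  exists u v : V, pgst_between R G u v.

Definition cycle_adj (n : nat) : rel 'Z_n :=
  fun a b => (a - b == 1) || (a - b == (n.-1)%:R).

Lemma cycle_adj_sym (n : nat) (n_ge3 : (2 < n)%N) : symmetric (@cycle_adj n).
Proof.
have e : (n.-1)%:R = -1 :> 'Z_n.
  by rewrite -subn1 natrB ?(ltn_trans _ n_ge3) // pchar_Zp ?sub0r // ltnW.
by move=> a b; rewrite /cycle_adj e -(opprB b a) eqr_oppLR eqr_opp orbC.
Qed.

Lemma cycle_adj_irrefl (n : nat) (n_ge3 : (2 < n)%N) :
  irreflexive (@cycle_adj n).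
Proof.
have e : (n.-1)%:R = -1 :> 'Z_n.
  by rewrite -subn1 natrB ?(ltn_trans _ n_ge3) // pchar_Zp ?sub0r // ltnW.
by move=> a; rewrite /cycle_adj e subrr !(eq_sym 0) oppr_eq0 oner_eq0.
Qed.

(* The hypothesis 2 < n also ensures that 'Z_n is the ring of integers mod n:
   'Z_0 and 'Z_1 are both Z/2. *)
Definition cycle_graph (n : nat) (n_ge3 : (2 < n)%N) : sgraph 'Z_n :=
  SGraph (cycle_adj_sym n_ge3) (cycle_adj_irrefl n_ge3).

(* Main.v *)
Require Import Defs.
From HB Require Import structures.
From mathcomp Require Import all_boot all_order all_algebra.
From mathcomp Require Import algC cyclotomic complex ring lra.
From mathcomp Require Import all_classical all_reals all_analysis.

(* The characters of Z/n diagonalise H(t), with eigenvalues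
   exp(-i t theta_j), theta_j = 2 cos(2 pi j / n).  Hence pretty good state
   transfer from u to v, with w = u - v, says exactly that
   exp(-i t_k theta_j) -> gamma zeta^(w j) for all j.

   Necessity: theta_1 = theta_(n-1) forces zeta^w = -1, so n is even.  If an
   odd prime p divides n and q = n / p, then q is even and
   sum_(s < p) theta_(j + s q) = 0, so gamma^p (-1)^(j p) = 1 for every j;
   j = 0 and j = 1 contradict each other.

   Sufficiency: for n = 4 d with d a power of 2, the numbers
   1, theta_1, ..., theta_(d-1) are linearly independent over Q because
   X^(2d) + 1 is irreducible.  Kronecker's theorem then gives times t in pi N
   with exp(-i t theta_j) close to (-1)^j for 0 < j < d, and the symmetries of
   the cosine propagate this to all j. *)

Set Implicit Arguments.
Unset Strict Implicit.
Unset Printing Implicit Defensive.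

Import Order.TTheory GRing.Theory Num.Theory numFieldNormedType.Exports.
Local Open Scope classical_set_scope.
Local Open Scope ring_scope.
Local Notation "x %:C" := (real_complex _ x) (format "x %:C") : ring_scope.
Local Notation "x +i* y" := (Complex x y) : ring_scope.

(** * Linear independence of powers of a root of unity of 2-power order *)

(** The order of [x] divides 2^(m+1), so it is some 2^l; with l <= m it would force
    [x ^+ (2 ^ m) = 1], and 1 differs from -1 here. *)
Lemma prim_root_expN1 (F : numDomainType) (m : nat) (x : F) :
  x ^+ (2 ^ m) = -1 -> (2 ^ m.+1).-primitive_root x.
Proof.
move=> xN1.
have x1 : x ^+ (2 ^ m.+1) = 1 by rewrite expnSr exprM xN1 sqrrN expr1n.
have [|k prim_x] := prim_order_exists _ x1; first by rewrite expn_gt0.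
case/(dvdn_pfactor _ _ (isT : prime 2)) => l.
rewrite leq_eqVlt => /predU1P[-> <- //|lm] Dk.
have := prim_x; rewrite Dk => /(prim_expr_order) xl.
have : x ^+ (2 ^ m) = 1.
  by rewrite -(subnKC (lm : (l <= m)%N)) expnD exprM xl expr1n.
by rewrite xN1 => /eqP; rewrite eqNr oner_eq0.
Qed.

(** X^(2^m) + 1 is irreducible over the rationals. As [F] is arbitrary, [z] only serves to show that
    the rational gcd of [P] and X^(2^m) + 1 is not constant; the gcd then has a root in [algC],
    where the minimal polynomial is cyclotomic of degree 2^m. *)
Lemma root_small_eq0 (F : numFieldType) (m : nat) (z : F) (P : {poly rat}) :
  z ^+ (2 ^ m) = -1 -> (size P <= 2 ^ m)%N ->
  root (map_poly ratr P) z -> P = 0.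
Proof.
move=> zN1 sP Pz; apply/eqP/negPn/negP => P0.
pose Q : {poly rat} := 'X^(2 ^ m) + 1.
have Qroot (K : numFieldType) (y : K) :
  root (map_poly ratr Q) y = (y ^+ (2 ^ m) == -1).
  by rewrite rmorphD rmorph1 /= map_polyXn rootE !hornerE addr_eq0.
have g0 : gcdp P Q != 0 by rewrite gcdp_eq0 negb_and P0.
have /closed_rootP[x] : size (map_poly (ratr : rat -> algC) (gcdp P Q)) != 1.
  rewrite size_map_poly neq_ltn; apply/orP; right.
  rewrite -(size_map_poly (ratr : {rmorphism rat -> F})).
  apply: (@root_size_gt1 _ z); first by rewrite map_poly_eq0.
  by rewrite gcdp_map root_gcd Pz Qroot zN1 /=.
rewrite gcdp_map root_gcd Qroot => /andP[Px /eqP /prim_root_expN1 prim_x].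
have [p [Dp _] dv_p] := minCpolyP x.
have := dvdp_leq P0 _; move/(_ p); rewrite -dv_p => /(_ Px).
rewrite -(size_map_poly (ratr : {rmorphism rat -> algC})) -Dp.
rewrite (minCpoly_cyclotomic prim_x) size_cyclotomic totient_pfactor // mul1n.
by move=> /leq_trans/(_ sP); rewrite ltnn.
Qed.

(** * Kronecker's theorem *)

Lemma ler_natmul_bound (R : archiRealFieldType) (a k : R) :
  (forall n : nat, a *+ n <= k) -> a <= 0.
Proof.
move=> ak; rewrite leNgt; apply/negP => a0.
have k0 : 0 <= k by have := ak 0%N; rewrite mulr0n.
have := archi_boundP (divr_ge0 k0 (ltW a0)).
rewrite ltr_pdivrMr // => kb.
have := ak (Num.bound (k / a)); rewrite -mulr_natl.
by rewrite leNgt kb.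
Qed.

(** With h = 1/q - 1, Bernoulli's inequality gives q^(-2L) >= (1 + L h)^2, which is quadratic in L,
    while N + 1 = 2 L d + 1 is only linear. *)
Lemma expr_natmul_lt1 (R : archiRealFieldType) (q : R) (d : nat) :
  0 <= q -> q < 1 -> exists N : nat, (N.+1)%:R ^+ d * q ^+ N < 1.
Proof.
move=> q0 q1; have [->|d0] := posnP d; first by exists 1%N; rewrite mul1r.
have [->|qn0] := eqVneq q 0; first by exists 1%N; rewrite expr1 mulr0.
have {q0 qn0} q0 : 0 < q by rewrite lt_def qn0.
pose h := q^-1 - 1; have h0 : 0 < h by rewrite subr_gt0 invf_gt1.
have bernoulli L : 1 + L%:R * h <= q^-1 ^+ L.
  elim: L => [|L IH]; first by rewrite mul0r addr0 expr0.
  have -> : q^-1 = 1 + h by rewrite /h; ring.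
  rewrite exprS -natr1.
  have : 1 + L%:R * h <= (1 + h) ^+ L by move: IH; rewrite {1}/h subrKC.
  have : 0 <= L%:R * h ^+ 2 by rewrite mulr_ge0 ?sqr_ge0.
  nra.
(* This makes L h^2 > 2 d, so (1 + L h)^2 > 1 + 2 L d = N + 1. *)
pose L := (Num.bound (2 * d%:R / h ^+ 2)).
have hL : 2 * d%:R < L%:R * h ^+ 2.
  rewrite -ltr_pdivrMr ?exprn_gt0 //; apply: archi_boundP.
  by rewrite divr_ge0 ?mulr_ge0 // ltW // exprn_gt0.
have L0 : 0 < L%:R :> R.
  by rewrite -(pmulr_lgt0 _ (exprn_gt0 2 h0)) (le_lt_trans _ hL) // mulr_ge0.
exists (2 * L * d)%N; rewrite exprM -exprMn exprn_ilt1 ?lt0n_neq0 //.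
  by rewrite mulr_ge0 ?exprn_ge0 // ltW.
rewrite -[q]invrK exprVn -ltr_pdivlMr ?invr_gt0 ?exprn_gt0 ?invr_gt0 //.
rewrite invrK mul1r [X in _ < _ ^+ X]mulnC exprM.
have : (1 + L%:R * h) ^+ 2 <= (q^-1 ^+ L) ^+ 2.
  rewrite lerXn2r ?nnegrE //; first by rewrite addr_ge0 ?mulr_ge0 // ltW.
  by rewrite exprn_ge0 // invr_ge0 ltW.
apply: lt_le_trans; rewrite -natr1 !natrM.
have -> : (1 + L%:R * h) ^+ 2 = 1 + 2 * (L%:R * h) + L%:R * (L%:R * h ^+ 2) by ring.
have := mulr_gt0 L0 h0.
have : L%:R * (2 * d%:R) < L%:R * (L%:R * h ^+ 2) by rewrite ltr_pM2l.
nra.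
Qed.

Section Kronecker.
Variable R : realType.
Local Notation C := (Cplx R).

Lemma norm_normc (x : C) : `|x| = (ComplexField.Normc.normc x)%:C.
Proof. by []. Qed.

(* Averaging over s against Z_i^(-s) isolates the coefficient c_i. *)
Lemma exp_sum_coef_le (I : finType) (c Z : I -> C) (b : R) :
  injective Z -> (forall i, `|Z i| = 1) ->
  (forall s : nat, `|\sum_i c i * Z i ^+ s| <= b%:C) ->
  forall i, `|c i| <= b%:C.
Proof.
move=> Zinj Z1 bound i.
have Z0 j : Z j != 0 by rewrite -normr_eq0 Z1 oner_neq0.
pose u j := Z j / Z i.
have u1 j : `|u j| = 1 by rewrite normrM normfV !Z1 divr1.
have un1 j : j != i -> 1 - u j != 0.
  move=> ji; rewrite subr_eq0; apply: contra ji => /eqP uj; apply/eqP/Zinj.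
  by rewrite -[RHS]mul1r uj divfK.
(* A geometric sum of [u j] has modulus at most 2 / |1 - u j| whatever its length, so the total
   error [k] does not depend on T and vanishes on division by T. *)
pose k := \sum_(j | j != i) `|c j| * (2 / `|1 - u j|).
have main T : `|c i| *+ T <= b%:C *+ T + k.
  have -> : `|c i| *+ T =
    `|\sum_(s < T) (\sum_j c j * Z j ^+ s) * (Z i)^-1 ^+ s -
      \sum_(j | j != i) c j * \sum_(s < T) u j ^+ s|.
    under [X in _ - X]eq_bigr do rewrite mulr_sumr.
    rewrite exchange_big /= -sumrB -normrMn; congr `|_|.
    rewrite -[LHS]/(c i *+ T) -[in LHS](card_ord T) -sumr_const.
    apply: eq_bigr => s _; rewrite mulr_suml (bigD1 i) //=.
    under eq_bigr do rewrite -mulrA -exprMn.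
    by rewrite addrK -mulrA -exprMn divff // expr1n mulr1.
  apply: (le_trans (ler_normB _ _)); apply: lerD.
    apply: (le_trans (ler_norm_sum _ _ _)).
    rewrite -[X in _ <= _ *+ X](card_ord T) -sumr_const; apply: ler_sum => s _.
    by rewrite normrM normrX normfV Z1 invr1 expr1n mulr1.
  apply: (le_trans (ler_norm_sum _ _ _)); apply: ler_sum => j ji.
  rewrite normrM ler_wpM2l // ler_pdivlMr ?normr_gt0 ?un1 // -normrM mulrC.
  rewrite -(opprB (u j)) mulNr -subrX1 normrN (le_trans (ler_normB _ _)) //.
  by rewrite normrX u1 expr1n normr1.
have kE : k = (complex.Re k)%:C.
  rewrite RRe_real //; apply/ger0_real/sumr_ge0 => j _.
  by rewrite mulr_ge0 // divr_ge0.
move: main; rewrite norm_normc kE lecR => main.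
rewrite -subr_le0; apply: (@ler_natmul_bound _ _ (complex.Re k)) => n.
by rewrite mulrnBl lerBlDl -lecR rmorphD !rmorphMn; exact: main.
Qed.

(** Simultaneous approximation in disguise: a point u of the unit circle with |1 + u| close to 2 is
    close to 1, so [z i ^+ s] is close to [w i] for all i at once. Independence makes distinct
    monomials in the [z i] distinct numbers, as the averaging bound requires. *)
Lemma kronecker_nat (I : finType) (z w : I -> C) (q : R) :
  (forall i, `|z i| = 1) -> (forall i, `|w i| = 1) ->
  (forall a b : {ffun I -> nat},
    \prod_i z i ^+ a i = \prod_i z i ^+ b i -> a = b) ->
  0 <= q -> q < 1 ->
  exists s : nat, forall i, (2 * q)%:C < `|1 + (w i)^-1 * z i ^+ s|.
Proof.
move=> z1 w1 indep q0 q1; apply: contrapT => nos.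
have {}nos s : exists i, `|1 + (w i)^-1 * z i ^+ s| <= (2 * q)%:C.
  apply: contrapT => nex; apply: nos; exists s => i.
  rewrite norm_normc ltcR ltNge; apply/negP => le; apply: nex; exists i.
  by rewrite norm_normc lecR.
have le2 i s : `|1 + (w i)^-1 * z i ^+ s| <= 2.
  apply: (le_trans (ler_normD _ _)).
  by rewrite normrM normfV normrX w1 z1 expr1n invr1 mulr1 normr1.
(* The coefficients of prod_i (1 + z_i^s / w_i)^N, as an exponential sum in s,
   have total mass 2^(N #|I|) spread over (N + 1)^#|I| terms, so one of them is
   too large if some factor always is at most 2 q. *)
have [N] := expr_natmul_lt1 #|I| q0 q1.
apply/negP; rewrite -leNgt.
pose c (f : {ffun I -> 'I_N.+1}) : C := \prod_i ('C(N, f i)%:R * (w i)^-1 ^+ f i).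
pose Z (f : {ffun I -> 'I_N.+1}) : C := \prod_i z i ^+ f i.
have Zinj : injective Z.
  move=> f g fg; have := indep [ffun i => f i : nat] [ffun i => g i : nat].
  under eq_bigr do rewrite ffunE; under [in X in _ = X -> _]eq_bigr do rewrite ffunE.
  move=> /(_ fg) /ffunP fgi; apply/ffunP => i; apply: val_inj.
  by have := fgi i; rewrite !ffunE.
have Z1 f : `|Z f| = 1.
  by rewrite normr_prod big1 // => i _; rewrite normrX z1 expr1n.
have prodE s : \sum_f c f * Z f ^+ s = \prod_i (1 + (w i)^-1 * z i ^+ s) ^+ N.
  under [RHS]eq_bigr do rewrite exprDn.
  rewrite bigA_distr_bigA; apply: eq_bigr => f _.
  rewrite /c /Z -prodrXl -big_split; apply: eq_bigr => i _ /=.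
  by rewrite expr1n mul1r -[RHS]mulr_natl exprMn -mulrA -!exprM [(f i * s)%N]mulnC.
(* For each s one factor is at most 2 q and the others at most 2, so the product is at most 2^#|I| q
   before raising to the N-th power. Comparing total masses gives 1 <= (N + 1)^#|I| q^N, against the
   choice of N. *)
pose b : R := (2 ^+ #|I| * q) ^+ N.
have bound s : `|\sum_f c f * Z f ^+ s| <= b%:C.
  rewrite prodE prodrXl normrX /b rmorphXn lerXn2r ?nnegrE //.
    by rewrite ler0c mulr_ge0 ?exprn_ge0.
  have [i lei] := nos s.
  rewrite normr_prod (bigD1 i) //=.
  have -> : (2 ^+ #|I| * q)%:C = (2 * q)%:C * \prod_(j | j != i) (2 : C).
    rewrite prodr_const cardC1 !rmorphM rmorphXn /= rmorph_nat.
    have : (0 < #|I|)%N by apply/card_gt0P; exists i.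
    by case: #|I| => // n _; rewrite exprS mulrAC.
  apply: ler_pM; rewrite ?prodr_ge0 //.
  by apply: ler_prod => j _; rewrite normr_ge0 le2.
have ub : \sum_f `|c f| <= b%:C *+ N.+1 ^ #|I|.
  apply: (le_trans (ler_sum _ (fun f _ => exp_sum_coef_le Zinj Z1 bound f))).
  by rewrite sumr_const card_ffun card_ord.
have sumE : \sum_f `|c f| = ((2 ^+ #|I|) ^+ N : R)%:C.
  rewrite !rmorphXn /= rmorph_nat.
  transitivity (\prod_(i : I) \sum_(a < N.+1) ('C(N, a)%:R : C)).
    rewrite bigA_distr_bigA; apply: eq_bigr => f _; rewrite normr_prod.
    apply: eq_bigr => i _.
    by rewrite normrM normrX normfV w1 invr1 expr1n mulr1 normr_nat.
  rewrite prodr_const -exprM mulnC exprM; congr (_ ^+ _).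
  rewrite -[2]/(1 + 1) exprDn; apply: eq_bigr => a _.
  by rewrite !expr1n mulr1.
move: ub; rewrite sumE -rmorphMn lecR /b exprMn -mulrnAr -[leLHS]mulr1 ler_pM2l
  ?exprn_gt0 //.
by rewrite -mulr_natl natrX.
Qed.
End Kronecker.

(** Take q = 1 - 1/(k + 1) at stage k; the parallelogram law |1 - u|^2 + |1 + u|^2 = 4 turns the
    lower bound on |1 + u| into an upper bound on |1 - u|. *)
Lemma kronecker_cvg (R : realType) (I : finType) (z w : I -> Cplx R) :
  (forall i, `|z i| = 1) -> (forall i, `|w i| = 1) ->
  (forall a b : {ffun I -> nat},
    \prod_i z i ^+ a i = \prod_i z i ^+ b i -> a = b) ->
  exists s : nat -> nat, forall i, (fun k => z i ^+ s k) @ \oo --> w i.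
Proof.
move=> z1 w1 indep.
have q0 k : 0 <= 1 - harmonic k :> R by rewrite subr_ge0 /= invf_le1 // ler1n.
have q1 k : 1 - harmonic k < 1 :> R by rewrite ltrBlDr ltrDl /= invr_gt0.
have [s Hs] := choice (fun k => kronecker_nat z1 w1 indep (q0 k) (q1 k)).
exists s => i; apply/cvgrPdist_lt => e e0.
have eE : e = (complex.Re e)%:C by rewrite RRe_real // gtr0_real.
have e'0 : 0 < complex.Re e by rewrite -ltcR -eE.
(* With h = [harmonic k], the bound is 4 - (2 (1 - h))^2 = 8 h - 4 h^2 < 8 h, hence the 8. *)
have := @cvgr_lt _ _ _ _ _ _ (@cvg_harmonic R) (complex.Re e ^+ 2 / 8).
rewrite divr_gt0 ?exprn_gt0 // => /(_ _ isT); apply: filterS => k hk.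
pose u := (w i)^-1 * z i ^+ s k.
have wi0 : w i != 0 by rewrite -normr_gt0 w1.
have u1 : `|u| = 1 by rewrite normrM normfV normrX z1 w1 expr1n invr1 mulr1.
have -> : `|w i - z i ^+ s k| = `|1 - u|.
  have -> : w i - z i ^+ s k = w i * (1 - u) by rewrite mulrBr mulr1 mulVKf.
  by rewrite normrM w1 mul1r.
have para : `|1 - u| ^+ 2 = 4 - `|1 + u| ^+ 2.
  have uu : u * u^*%R = 1 by rewrite -normCK u1 expr1n.
  rewrite !normCK !rmorphB !rmorphD !rmorph1.
  have -> : (1 - u) * (1 - u^*) = 1 + u * u^* - u - u^* by ring.
  have -> : (1 + u) * (1 + u^*) = 1 + u * u^* + u + u^* by ring.
  by rewrite uu; ring.
rewrite -(@ltr_pXn2r _ 2) ?nnegrE // ?(ltW e0) // para.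
have -> : e ^+ 2 = (complex.Re e ^+ 2)%:C by rewrite {1}eE rmorphXn.
apply: (@lt_trans _ _ (4 - ((2 * (1 - harmonic k))%:C) ^+ 2)).
  rewrite ltrD2l ltrN2 ltr_pXn2r ?nnegrE //; first exact: Hs.
  by rewrite ler0c mulr_ge0 ?q0.
rewrite -rmorphXn -[4](rmorph_nat (real_complex R)) -rmorphB ltcR.
have : 0 < harmonic k :> R by rewrite /= invr_gt0.
move: hk; set h := harmonic k; rewrite ltr_pdivlMr // => hk h0.
have := sqr_ge0 h; nra.
Qed.

(** * The complex exponential on the imaginary axis *)

Section Cis.
Variable R : realType.
Local Notation C := (Cplx R).

Definition cis (x : R) : C := cos x +i* sin x.

Lemma cisD (x y : R) : cis (x + y) = cis x * cis y.
Proof. by rewrite /cis cosD sinD [_ + cos x * sin y]addrC. Qed.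

Lemma cis0 : cis 0 = 1.
Proof. by rewrite /cis cos0 sin0. Qed.

Lemma cisN (x : R) : cis (- x) = (cis x)^-1.
Proof.
have := cisD x (- x); rewrite subrr cis0 => /esym xN1.
have x0 : cis x != 0.
  by apply: contra_eq_neq xN1 => ->; rewrite mul0r eq_sym oner_neq0.
by apply: (mulfI x0); rewrite xN1 divff.
Qed.

Lemma norm_cis (x : R) : `|cis x| = 1.
Proof. by rewrite normc_def /= cos2Dsin2 sqrtr1. Qed.

Lemma cisX (x : R) (n : nat) : cis (x *+ n) = cis x ^+ n.
Proof.
by elim: n => [|n IH]; rewrite ?mulr0n ?cis0 ?expr0 // mulrSr cisD IH exprSr.
Qed.

Lemma cis_sum (I : Type) (r : seq I) (P : pred I) (F : I -> R) :
  cis (\sum_(i <- r | P i) F i) = \prod_(i <- r | P i) cis (F i).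
Proof. by apply: big_morph => [x y|]; [exact: cisD | exact: cis0]. Qed.

Lemma cis_pi : cis pi = -1.
Proof. by rewrite /cis cospi sinpi; apply/eqP; rewrite eq_complex /= oppr0 !eqxx. Qed.

Lemma cis_2pi : cis (pi *+ 2) = 1.
Proof. by rewrite cisX cis_pi sqrrN expr1n. Qed.

Lemma cisDcisN (x : R) : cis x + cis (- x) = (2 * cos x)%:C.
Proof.
rewrite /cis cosN sinN; apply/eqP; rewrite eq_complex /= subrr eqxx.
by rewrite andbT; apply/eqP; ring.
Qed.

(** Reduce x to y in [0, 2 pi). Then cos y = 1 gives sin (y / 2) = 0, whereas sin is positive on (0,
    pi), so y = 0. *)
Lemma cis_eq1 (x : R) : cis x = 1 -> exists m : int, x = (pi *+ 2) * m%:~R.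
Proof.
move=> x1; pose p2 : R := pi *+ 2.
have p0 : 0 < p2 by rewrite mulrn_wgt0 // pi_gt0.
exists (Num.floor (x / p2)); set m := Num.floor _.
have /andP[] := floor_itv (x / p2).
rewrite -/m ler_pdivlMr // ltr_pdivrMr // intrD mulrDl mul1r => mx xm.
pose y := x - p2 * m%:~R.
suff : y = 0 by move/eqP; rewrite subr_eq0 => /eqP.
have y0 : 0 <= y by rewrite subr_ge0 mulrC.
have y1 : y < p2 by rewrite /y mulrC ltrBlDl.
have cy : cis y = 1.
  have cpm k : cis (p2 * k%:~R) = 1.
    have cpn n : cis (p2 * n%:R) = 1 by rewrite mulr_natr cisX cis_2pi expr1n.
    by case: k => n; rewrite ?NegzE ?rmorphN ?mulrN ?cisN cpn ?invr1.
  by rewrite /y cisD x1 cisN cpm invr1 mulr1.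
have [cosy siny] : cos y = 1 /\ sin y = 0 by case: cy.
have y2 : y / 2 *+ 2 = y by rewrite -mulr_natr divfK.
have := cos_mulr2n (y / 2); rewrite y2 cosy => cy2.
have sy2 : sin (y / 2) = 0.
  apply/eqP; rewrite -sqrf_eq0 sin2cos2 subr_eq0; apply/eqP; lra.
apply/eqP; rewrite eq_le y0 andbT leNgt; apply/negP => ygt0.
have /sin_gt0_pi : 0 < y / 2 < pi.
  by rewrite divr_gt0 //= ltr_pdivrMr // mulr_natr.
by rewrite sy2 ltxx.
Qed.

Lemma continuous_real_complex : continuous (real_complex R : R -> C).
Proof.
move=> x; apply/cvgrPdist_lt => e e0.
have eE : e = (complex.Re e)%:C by rewrite RRe_real // gtr0_real.
have e'0 : 0 < complex.Re e by rewrite -ltcR -eE.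
near=> y; rewrite -rmorphB /= eE normc_def /= expr0n addr0 sqrtr_sqr ltcR.
near: y; exact: cvgr_dist_lt.
Unshelve. all: by end_near. Qed.

Lemma cvg_real_complex (u : nat -> R) (l : R) :
  u @ \oo --> l -> (fun k => (u k)%:C : C) @ \oo --> (l%:C : C).
Proof. by move=> ul; apply: (continuous_cvg _ (@continuous_real_complex l)). Qed.

(** Even powers of i x make up the cosine series, odd ones i times the sine series. *)
Lemma cvg_exp_cis (x : R) :
  series (fun k : nat => (k`!%:R)^-1 * ('i%C * x%:C) ^+ k : C) @ \oo --> cis x.
Proof.
have -> : series (fun k : nat => (k`!%:R)^-1 * ('i%C * x%:C) ^+ k : C) =
  (fun n => (series (cos_coeff x) n)%:C + 'i%C * (series (sin_coeff x) n)%:C).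
  apply/funext => n; rewrite /series /= !rmorph_sum mulr_sumr -big_split /=.
  apply: eq_bigr => k _; rewrite /cos_coeff /sin_coeff /= exprMn.
  have i2 : ('i%C : C) ^+ 2 = -1 by exact: sqr_i.
  have ik : ('i%C : C) ^+ k = (-1) ^+ k./2 * 'i%C ^+ odd k.
    by rewrite -{1}[k]odd_double_half addnC exprD -mul2n exprM i2.
  pose a : R := (-1) ^+ k./2 * x ^+ k / k`!%:R.
  have lhsE : (k`!%:R)^-1 * (('i%C : C) ^+ k * x%:C ^+ k) = 'i%C ^+ odd k * a%:C.
    rewrite ik /a !rmorphM fmorphV !rmorphXn rmorphN rmorph1 rmorph_nat /=.
    by rewrite mulrC [_ * 'i%C ^+ _]mulrC -!mulrA.
  have -> : ((~~ odd k)%:R * (-1) ^ k./2 * x ^+ k / k`!%:R : R) = (~~ odd k)%:R * a.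
    by rewrite /a !mulrA.
  case ok: (odd k) lhsE => /= lhsE.
    (* [sin_coeff] takes its sign from [k.-1./2], the same as [k./2] for odd k. *)
    have -> : k.-1./2 = k./2.
      rewrite -[k in RHS]odd_double_half ok /= uphalf_double.
      by rewrite -[k in LHS]odd_double_half ok /= half_double.
    by rewrite lhsE mul0r add0r mul1r /a.
  by rewrite lhsE !mul0r !rmorph0 mulr0 addr0 !mul1r.
have -> : cis x = (cos x)%:C + 'i%C * (sin x)%:C by exact: complexE.
apply: cvgD; first apply: cvg_real_complex.
  by rewrite unlock; exact: is_cvg_series_cos_coeff.
apply: cvgM; first exact: cvg_cst.
 apply: cvg_real_complex.
by rewrite unlock; exact: is_cvg_series_sin_coeff.
Qed.
End Cis.

(** * The transition matrix of a cycle *)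

Lemma cvg_mxP (K : numFieldType) (m p : nat) (u : nat -> 'M[K]_(m, p))
    (M : 'M[K]_(m, p)) :
  u @ \oo --> M <-> forall i j, (fun k => u k i j) @ \oo --> M i j.
Proof.
split=> [uM i j|uM A [P MP PA]].
  exact: (cvg_comp _ _ uM (@coord_continuous K m p i j M)).
have : \forall k \near \oo, forall i j, P i j (u k i j).
  apply: filter_forall => i; apply: filter_forall => j; exact: uM.
by apply: filterS => k; exact: PA.
Qed.

Lemma cvg_sum_seq (K : numFieldType) (I : Type) (r : seq I) (P : pred I)
    (f : I -> nat -> K) (l : I -> K) :
  (forall i, P i -> f i @ \oo --> l i) ->
  (fun k => \sum_(i <- r | P i) f i k) @ \oo --> \sum_(i <- r | P i) l i.
Proof. by move=> fl; apply: cvg_big => //; exact: add_continuous. Qed.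

Lemma cvg_prod_seq (K : numFieldType) (I : Type) (r : seq I) (P : pred I)
    (f : I -> nat -> K) (l : I -> K) :
  (forall i, P i -> f i @ \oo --> l i) ->
  (fun k => \prod_(i <- r | P i) f i k) @ \oo --> \prod_(i <- r | P i) l i.
Proof. by move=> fl; apply: cvg_big => //; exact: mul_continuous. Qed.

Lemma sum_unity_root (F : idomainType) (n : nat) (y : F) :
  y ^+ n = 1 -> \sum_(b < n) y ^+ b = if y == 1 then n%:R else 0.
Proof.
move=> yn; case: eqVneq => [->|y1].
  by under eq_bigr do rewrite expr1n; rewrite sumr_const card_ord.
apply/eqP; have /eqP := subrX1 y n; rewrite yn subrr eq_sym mulf_eq0 subr_eq0.
by rewrite (negPf y1).
Qed.

Section Cycle.
Variables (R : realType) (n : nat) (n_ge3 : (2 < n)%N).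
Local Notation C := (Cplx R).
Local Notation G := (cycle_graph n_ge3).

Definition zeta : C := cis (pi *+ 2 / n%:R).
Definition theta (j : nat) : R := 2 * cos (pi *+ 2 / n%:R *+ j).

Let n_gt0 : (0 < n)%N := ltnW (ltnW n_ge3).
Let n0 : n%:R != 0 :> C. Proof. by rewrite pnatr_eq0 -lt0n. Qed.
Let nE : (Zp_trunc n).+2 = n := Zp_cast (ltnW n_ge3).

Lemma zeta_neq0 : zeta != 0.
Proof. by rewrite -normr_gt0 norm_cis. Qed.

Lemma zetaX (k : nat) : zeta ^+ k = cis (pi *+ 2 / n%:R *+ k).
Proof. by rewrite cisX. Qed.

Lemma zeta_n : zeta ^+ n = 1.
Proof.
by rewrite zetaX -mulr_natr divfK ?cis_2pi // pnatr_eq0 -lt0n.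
Qed.

(** If k is the order, [cis_eq1] makes k / n an integer; as k also divides n, they agree. *)
Lemma zeta_prim : n.-primitive_root zeta.
Proof.
have [k prim_k kn] := prim_order_exists n_gt0 zeta_n.
suff -> : n = k by [].
apply/eqP; rewrite eqn_dvd kn andbT; have := prim_expr_order prim_k.
rewrite zetaX => /cis_eq1[m].
rewrite -mulr_natr -mulrA => /(mulfI _) => km.
have {}km : k%:R = n%:R * m%:~R :> R.
  rewrite -km; first by rewrite mulVKf // pnatr_eq0 -lt0n.
  by rewrite gt_eqF // mulrn_wgt0 // pi_gt0.
have /esym Dk : (k%:Z = n%:Z * m)%R.
  by apply: (@intr_inj R); rewrite rmorphM; exact: km.
have : (n%:Z %| k%:Z)%Z by rewrite -Dk dvdz_mulr.
by rewrite dvdzE.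
Qed.

(** The exponents are natural representatives, and addition in ['Z_n] reduces modulo n; this is
    harmless because [zeta ^+ n = 1]. *)
Lemma zetaD (x y : 'Z_n) (j : nat) :
  zeta ^+ ((x + y)%R * j) = zeta ^+ (x * j) * zeta ^+ (y * j).
Proof.
rewrite -exprD -mulnDl [LHS]exprM [RHS]exprM; congr (_ ^+ j).
have zn : zeta ^+ (Zp_trunc n).+2 = 1 by rewrite nE zeta_n.
exact: expr_mod.
Qed.

Lemma zeta_mod (w j : nat) : zeta ^+ (w * (j %% n)) = zeta ^+ (w * j).
Proof. by rewrite mulnC exprM expr_mod ?zeta_n // -exprM mulnC. Qed.

Lemma zetaDV (j : nat) : zeta ^+ j + zeta ^- j = (theta j)%:C.
Proof. by rewrite zetaX -cisN cisDcisN. Qed.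

Lemma zeta_eq1 (w : 'Z_n) : (zeta ^+ w == 1) = (w == 0).
Proof.
rewrite -(prim_order_dvd zeta_prim) /dvdn modn_small //.
by rewrite -[X in (_ < X)%N]nE.
Qed.

Lemma theta_mod (j : nat) : theta (j %% n) = theta j.
Proof.
apply: (@complexI R); rewrite -!zetaDV -!exprVn !expr_mod //.
  by rewrite exprVn zeta_n invr1.
exact: zeta_n.
Qed.

Lemma thetaN (j : nat) : (j <= n)%N -> theta (n - j) = theta j.
Proof.
move=> jn; apply: (@complexI R); rewrite -!zetaDV addrC.
have -> : zeta ^+ (n - j) = zeta ^- j.
  by rewrite exprB ?zeta_n ?div1r // unitfE -normr_gt0 norm_cis.
by rewrite invrK.
Qed.

Lemma sum_zeta_col (w : 'Z_n) :
  \sum_(j < n) zeta ^+ (w * j) = if w == 0 then n%:R else 0.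
Proof.
under eq_bigr do rewrite exprM.
by rewrite sum_unity_root ?zeta_eq1 // -exprM mulnC exprM zeta_n expr1n.
Qed.

(** Orthogonality of two characters, summed over the group; it inverts the Fourier transform in
    [pgst_cycleP]. [sum_zeta_col] is the dual relation, summed over the characters. *)
Lemma sum_zeta_row (i j : 'I_n) :
  \sum_(b : 'Z_n) zeta ^+ (b * i) * zeta ^+ ((- b)%R * j) =
  if i == j then n%:R else 0.
Proof.
pose y : C := zeta ^+ i * zeta ^- j.
have zetaN (b : 'Z_n) : zeta ^+ ((- b)%R * j) = zeta ^- (b * j).
  apply: (mulIf (expf_neq0 (b * j) zeta_neq0)).
  by rewrite -zetaD addNr mul0n expr0 mulVf // expf_neq0 // zeta_neq0.
have -> : \sum_(b : 'Z_n) zeta ^+ (b * i) * zeta ^+ ((- b)%R * j) =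
    \sum_(b < (Zp_trunc n).+2) y ^+ b.
  apply: eq_bigr => b _; rewrite zetaN mulnC [(b * j)%N]mulnC !exprM.
  by rewrite -exprVn -exprMn.
rewrite -(big_mkord xpredT (fun b => y ^+ b)) nE big_mkord sum_unity_root.
  rewrite -(inj_eq (mulIf (expf_neq0 j zeta_neq0))) mul1r mulfVK; last first.
    by rewrite expf_neq0 // zeta_neq0.
  by rewrite (eq_prim_root_expr zeta_prim) !modn_small.
by rewrite exprMn exprVn -!exprM ![(_ * n)%N]mulnC !exprM zeta_n !expr1n invr1 mulr1.
Qed.

(** The two neighbours are distinct because 2 is nonzero modulo n >= 3. *)
Lemma cycle_adj_sum (f : 'Z_n -> C) (a : 'Z_n) :
  \sum_(c : 'Z_n) (cycle_adj a c)%:R * f c = f (a - 1) + f (a + 1).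
Proof.
have e : (n.-1)%:R = -1 :> 'Z_n.
  by rewrite -subn1 natrB ?(ltn_trans _ n_ge3) // pchar_Zp ?sub0r // ltnW.
have ne : a + 1 != a - 1.
  rewrite (inj_eq (addrI a)) -addr_eq0 -(natrD _ 1 1).
  apply/eqP => /(congr1 (@nat_of_ord _)).
  by rewrite (val_Zp_nat (ltnW n_ge3)) modn_small.
rewrite (bigD1 (a - 1)) //= (bigD1 (a + 1)) //= big1 => [|c /andP[c1 c2]].
  by rewrite /cycle_adj e !opprD !addrA !subrr !sub0r opprK !eqxx orbT !mul1r addr0.
rewrite /cycle_adj e; case: eqP => [ac|_] /=.
  by rewrite -ac opprB addrC subrK eqxx in c1.
case: eqP => [ac|_] /=; last by rewrite mul0r.
by rewrite -[1]opprK -ac opprB addrC subrK eqxx in c2.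
Qed.

(** Spectral decomposition, by induction on k: the base case is orthogonality, and averaging a
    character over the shifts a - 1 and a + 1 without normalisation multiplies it by its eigenvalue
    [theta j]. *)
Lemma expr_adjmx_cycle (s : C) (k : nat) (a b : 'Z_n) :
  ((s *: adjmx R G) ^+ k) (enum_rank a) (enum_rank b) =
  n%:R^-1 * \sum_(j < n) (s * (theta j)%:C) ^+ k * zeta ^+ ((a - b)%R * j).
Proof.
elim: k a => [|k IH] a.
  rewrite expr0 mxE (inj_eq enum_rank_inj).
  under eq_bigr do rewrite expr0 mul1r.
  rewrite sum_zeta_col subr_eq0; case: eqP => _; first by rewrite mulVf.
  by rewrite mulr0.
rewrite exprS mxE (reindex _ (onW_bij _ (@enum_rank_bij 'Z_n))) /=.
under eq_bigr => c _ do rewrite IH !mxE !enum_rankK -mulrA.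
rewrite -mulr_sumr cycle_adj_sum -mulrDr mulrCA; congr (_ * _).
rewrite -big_split mulr_sumr; apply: eq_bigr => j _.
have zeta1 : zeta ^+ ((1%R : 'Z_n) * j) = zeta ^+ j by rewrite mul1n.
have zetaN1 : zeta ^+ (((-1)%R : 'Z_n) * j) = zeta ^- j.
  apply: (mulfI (expf_neq0 j zeta_neq0)); rewrite -{1}zeta1 -zetaD subrr mul0n.
  by rewrite divff // expf_neq0 // zeta_neq0.
have step : zeta ^+ ((a - 1 - b)%R * j) + zeta ^+ ((a + 1 - b)%R * j) =
    (theta j)%:C * zeta ^+ ((a - b)%R * j).
  rewrite -zetaDV [(a - 1 - b)%R]addrAC [(a + 1 - b)%R]addrAC !zetaD zeta1 zetaN1.
  by rewrite -mulrDr mulrC [zeta ^- j + _]addrC.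
by rewrite exprSr -!mulrA -step [RHS]mulrCA [in RHS]mulrDr.
Qed.

(** The exponential series is summed eigenvalue by eigenvalue. As [limn] is total, the value comes
    from proving entrywise convergence to the claimed matrix [M]. *)
Lemma transition_cycle (t : R) (a b : 'Z_n) :
  transition G t (enum_rank a) (enum_rank b) =
  n%:R^-1 * \sum_(j < n) cis (- (t * theta j)) * zeta ^+ ((a - b)%R * j).
Proof.
pose M : 'M[C]_#|'Z_n| := \matrix_(x, y) (n%:R^-1 *
  \sum_(j < n) cis (- (t * theta j)) *
    zeta ^+ (((enum_val x : 'Z_n) - enum_val y)%R * j)).
suff MP : transition G t = M by rewrite MP mxE !enum_rankK.
apply: cvg_lim; first exact: norm_hausdorff.
apply/cvg_mxP => x y; rewrite -[x]enum_valK -[y]enum_valK.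
move: (enum_val x) (enum_val y) => {}a {}b; rewrite mxE !enum_rankK.
set s : C := - _.
have -> : (fun k => series (fun k => (k`!%:R)^-1 *: (s *: adjmx R G) ^+ k) k
    (enum_rank a) (enum_rank b)) =
  (fun k => n%:R^-1 * \sum_(j < n)
    series (fun k => (k`!%:R)^-1 * ('i%C * (- (t * theta j))%:C) ^+ k : C) k
    * zeta ^+ ((a - b)%R * j)).
  apply/funext => k; rewrite /series /= summxE.
  under [in RHS]eq_bigr do rewrite mulr_suml.
  rewrite exchange_big mulr_sumr; apply: eq_bigr => l _ /=.
  rewrite mxE expr_adjmx_cycle mulrCA mulr_sumr; congr (_ * _).
  apply: eq_bigr => j _; rewrite mulrA; congr (_ * _ ^+ _ * _).
  by rewrite /s mulNr -mulrA -rmorphM -mulrN -rmorphN.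
apply: cvgM; first exact: cvg_cst.
apply: cvg_sum_seq => j _; apply: cvgM; last exact: cvg_cst.
exact: cvg_exp_cis.
Qed.
End Cycle.

(** Column u of H(t) is the inverse Fourier transform of the phases, so convergence of the entries
    and convergence of the phases imply each other through finite sums. Only the difference w = u -
    v matters. *)
Lemma pgst_cycleP (R : realType) (n : nat) (n_ge3 : (2 < n)%N) :
  pgst R (cycle_graph n_ge3) <->
  exists (w : 'Z_n) (t : nat -> R) (gamma : Cplx R),
    [/\ w != 0, `|gamma| = 1 & forall j : nat,
      (fun k => cis (- (t k * theta R n j))) @ \oo -->
        gamma * zeta R n ^+ (w * j)].
Proof.
have n0 : n%:R != 0 :> Cplx R by rewrite pnatr_eq0 -lt0n ltnW // ltnW.
have entries (t : nat -> R) (gamma : Cplx R) (u v : 'Z_n) :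
  (fun k => transition (cycle_graph n_ge3) (t k) *m vertex_vec R u) @ \oo
      --> gamma *: vertex_vec R v <->
  forall a : 'Z_n, (fun k => transition (cycle_graph n_ge3) (t k)
    (enum_rank a) (enum_rank u)) @ \oo --> gamma * (a == v)%:R.
  rewrite cvg_mxP; split=> [h a|h x y].
    have := h (enum_rank a) 0; rewrite /vertex_vec !mxE (inj_eq enum_rank_inj) andbT.
    by under eq_fun => k do rewrite -colE mxE.
  rewrite (ord1 y) -[x]enum_valK; move: (enum_val x) => a.
  rewrite /vertex_vec !mxE (inj_eq enum_rank_inj) andbT.
  under eq_fun => k do rewrite -colE mxE.
  exact: h.
split=> [[u [v [/eqP uv [t [gamma [g1 /entries H]]]]]]|[w [t [gamma [w0 g1 H]]]]].
  exists (u - v), t, gamma; split=> [||j]; rewrite ?subr_eq0 //.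
  wlog jn : j / (j < n)%N => [hw|].
    have := hw _ (ltn_pmod j (ltnW (ltnW n_ge3))).
    rewrite (theta_mod R n_ge3) (zeta_mod R n_ge3 (u - v)%R j); exact.
  (* Fourier inversion recovers each phase from column u. *)
  have inv k : cis (- (t k * theta R n j)) = \sum_(a : 'Z_n)
      transition (cycle_graph n_ge3) (t k) (enum_rank a) (enum_rank u) *
      zeta R n ^+ ((u - a)%R * j).
    under eq_bigr => a _ do rewrite transition_cycle -mulrA mulr_suml.
    rewrite -mulr_sumr exchange_big /=.
    have sumE (i : 'I_n) : \sum_(a : 'Z_n) cis (- (t k * theta R n i)) *
        zeta R n ^+ ((a - u)%R * i) * zeta R n ^+ ((u - a)%R * j) =
        if i == Ordinal jn then n%:R * cis (- (t k * theta R n i)) else 0.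
      under eq_bigr => a _ do rewrite -mulrA -(opprB a u).
      rewrite -mulr_sumr (reindex_inj (addIr u)).
      under eq_bigr => a _ do rewrite addrK.
      rewrite (sum_zeta_row R n_ge3 i (Ordinal jn)) [LHS]mulrC.
      by case: eqP => // _; rewrite mul0r.
    under eq_bigr => i _ do rewrite sumE.
    by rewrite -big_mkcond big_pred1_eq mulKf.
  under eq_fun => k do rewrite inv.
  have -> : gamma * zeta R n ^+ ((u - v)%R * j) = \sum_(a : 'Z_n)
      (gamma * (a == v)%:R) * zeta R n ^+ ((u - a)%R * j).
    rewrite (bigD1 v) //= eqxx mulr1 big1 ?addr0 // => a /negPf ->.
    by rewrite mulr0 mul0r.
  apply: cvg_sum_seq => a _; apply: cvgM; [exact: H|exact: cvg_cst].
(* Any pair with difference w would do; 0 and -w is the simplest. *)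
exists 0, (- w); split; first by move/esym/eqP; rewrite oppr_eq0 (negPf w0).
exists t, gamma; split=> //; apply/entries => a.
under eq_fun => k do rewrite transition_cycle subr0.
have -> : gamma * (a == - w)%:R = n%:R^-1 *
    \sum_(j < n) gamma * zeta R n ^+ (w * j) * zeta R n ^+ (a * j).
  under eq_bigr => j _ do rewrite -mulrA -(zetaD R n_ge3 w a).
  rewrite -mulr_sumr. rewrite sum_zeta_col // addrC addr_eq0.
  by case: eqP => _ /=; rewrite ?mulr0 // mulrCA mulVf.
apply: cvgM; first exact: cvg_cst.
apply: cvg_sum_seq => j _; apply: cvgM; [exact: H|exact: cvg_cst].
Qed.

(** * Necessity *)

Lemma pgst_cycle_pow2 (R : realType) (n : nat) (n_ge3 : (2 < n)%N) :
  pgst R (cycle_graph n_ge3) -> exists k : nat, (2 <= k)%N /\ n = (2 ^ k)%N.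
Proof.
move=> /pgst_cycleP[w [t [gamma [w0 g1 H]]]].
have n_gt0 : (0 < n)%N by rewrite ltnW // ltnW.
set y := zeta R n ^+ w; have {}H j : (fun k => cis (- (t k * theta R n j))) @ \oo
    --> gamma * y ^+ j by rewrite /y -exprM.
have g0 : gamma != 0 by rewrite -normr_gt0 g1.
have cvg_eq (f : nat -> Cplx R) (a b : Cplx R) :
    f @ \oo --> a -> f @ \oo --> b -> a = b.
  move=> fa fb; rewrite -(cvg_lim (@norm_hausdorff _ _) fa).
  by rewrite (cvg_lim (@norm_hausdorff _ _) fb).
have yn : y ^+ n = 1 by rewrite -exprM mulnC exprM zeta_n // expr1n.
have y1 : y != 1 by rewrite zeta_eq1.
(* Equal eigenvalues have equal phase limits, so y = y^(n-1) and y^2 = y^n = 1. *)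
have yN1 : y = -1.
  have Hn1 := H (n - 1)%N; rewrite thetaN // in Hn1.
  have /(mulfI g0) := cvg_eq _ _ _ (H 1%N) Hn1.
  move=> /(congr1 ( *%R y)); rewrite -!exprS subn1 prednK // yn.
  by move/eqP; rewrite sqrf_eq1 (negPf y1) => /eqP.
have n_even : ~~ odd n.
  apply/negP => on; move: yn; rewrite yN1 -signr_odd on => /eqP.
  by rewrite expr1 eqNr oner_eq0.
have p2 p : prime p -> (p %| n)%N -> p = 2%N.
  move=> pp pn; apply/eqP/negPn/negP => pneq2.
  have op : odd p by case: (even_prime pp) pneq2 => // ->.
  pose q := (n %/ p)%N; have nq : n = (p * q)%N by rewrite mulnC divnK.
  have q_even : ~~ odd q by move: n_even; rewrite nq oddM op.
  (* [zeta ^+ q] is a p-th root of unity other than 1, so its powers sum to 0, and so do those of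
     its inverse. *)
  have thetas j : \sum_(s < p) theta R n (j + s * q) = 0.
    apply: (@complexI R).
    have -> : (\sum_(s < p) theta R n (j + s * q))%:C =
      \sum_(s < p) (theta R n (j + s * q))%:C by exact: rmorph_sum.
    have zq1 : zeta R n ^+ q != 1.
      rewrite -(prim_order_dvd (zeta_prim R n_ge3)) gtnNdvd ?divn_gt0 ?prime_gt0 //.
        by rewrite dvdn_leq.
      by rewrite ltn_Pdiv // prime_gt1.
    have zqp : (zeta R n ^+ q) ^+ p = 1 by rewrite -exprM mulnC -nq zeta_n.
    transitivity (zeta R n ^+ j * \sum_(s < p) (zeta R n ^+ q) ^+ s +
        zeta R n ^- j * \sum_(s < p) (zeta R n ^- q) ^+ s).
      rewrite !mulr_sumr -big_split; apply: eq_bigr => s _.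
      rewrite -zetaDV exprD invfM mulnC exprM; congr (_ + _ * _).
      by rewrite exprVn.
    rewrite !sum_unity_root ?invr_eq1 ?(negPf zq1) ?mulr0 ?addr0 //.
    by rewrite exprVn zqp invr1.
  (* The phases multiply to exactly 1 at every time, hence so do their limits. *)
  have prod1 j : \prod_(s < p) (gamma * y ^+ (j + s * q)) = 1.
    apply: (cvg_eq (fun k => \prod_(s < p) cis (- (t k * theta R n (j + s * q))))).
      by apply: cvg_prod_seq => s _; exact: H.
    under eq_fun => k do rewrite -cis_sum sumrN -mulr_sumr thetas mulr0 oppr0 cis0.
    exact: cvg_cst.
  have prodE j : \prod_(s < p) (gamma * y ^+ (j + s * q)) = gamma ^+ p * y ^+ j.
    rewrite big_split prodr_const card_ord; congr (_ * _).
    under eq_bigr => s _.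
      rewrite yN1 exprD -[X in _ * X]signr_odd oddM (negPf q_even) andbF mulr1.
      over.
    by rewrite prodr_const card_ord yN1 exprAC -[(-1) ^+ p]signr_odd op expr1.
  have := prod1 1%N; have := prod1 0%N; rewrite !prodE expr0 mulr1 => ->.
  by rewrite yN1 mul1r => /eqP; rewrite expr1 eqNr oner_eq0.
exists (logn 2 n).
have n2 : n = (2 ^ logn 2 n)%N.
  rewrite -p_part part_pnat_id //.
  apply/pnatP => // p pp pn; by rewrite (p2 p pp pn) inE.
split => //; move: n_ge3; rewrite {1}n2.
by case: (logn 2 n) => [|[|]].
Qed.

(** * Sufficiency *)

Lemma zeta_half (R : realType) (m : nat) :
  zeta R (2 ^ m.+2) ^+ (2 ^ m.+1) = -1.
Proof.
have n3 : (2 < 2 ^ m.+2)%N by apply: (@leq_trans (2 ^ 2)) => //; rewrite leq_exp2l.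
have /eqP : zeta R (2 ^ m.+2) ^+ (2 ^ m.+1) ^+ 2 = 1 by rewrite -exprM -expnSr zeta_n.
rewrite sqrf_eq1 -(prim_order_dvd (zeta_prim R n3)).
by rewrite dvdn_Pexp2l // ltnn /= => /eqP.
Qed.

(** Multiplying the relation by [zeta ^+ d] turns [theta k] into zeta^(d+k) + zeta^(d-k). This gives
    a rational polynomial of degree below 2 d vanishing at zeta, hence zero, and its coefficient of
    exponent d + i + 1 is [c i]. The index is shifted so that [theta 0] is left out. *)
Lemma theta_indep (R : realType) (m : nat) (c : 'I_(2 ^ m).-1 -> int) (l : int) :
  \sum_i (c i)%:~R * theta R (2 ^ m.+2) i.+1 = 2 * l%:~R -> forall i, c i = 0.
Proof.
set d := (2 ^ m)%N => rel i.
have d0 : (0 < d)%N by rewrite expn_gt0.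
have n3 : (2 < 2 ^ m.+2)%N by apply: (@leq_trans (2 ^ 2)) => //; rewrite leq_exp2l.
set z := zeta R (2 ^ m.+2).
have z0 : z != 0 := zeta_neq0 R _.
pose P : {poly rat} := \sum_i (c i)%:~R *: ('X^(d + i.+1) + 'X^(d - i.+1))
  - (2 * l%:~R) *: 'X^d.
have il (k : 'I_d.-1) : (k.+1 < d)%N by have := ltn_ord k; rewrite -ltnS prednK.
have sizeP : (size P <= 2 ^ m.+1)%N.
  rewrite expnS mul2n -addnn -/d.
  rewrite (leq_trans (size_polyD _ _)) // size_polyN geq_max; apply/andP; split.
    apply: (leq_trans (size_sum _ _ _)); apply/bigmax_leqP => k _.
    rewrite (leq_trans (size_scale_leq _ _)) // (leq_trans (size_polyD _ _)) //.
    rewrite !size_polyXn geq_max ltn_add2l il /=.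
    by rewrite (leq_ltn_trans (leq_subr _ _)) // -addn1 leq_add2l.
  by rewrite (leq_trans (size_scale_leq _ _)) // size_polyXn -addn1 leq_add2l.
have zN1 : z ^+ (2 ^ m.+1) = -1 := zeta_half R m.
have Pz : root (map_poly ratr P) z.
  rewrite rootE rmorphB rmorph_sum /= hornerD hornerN horner_sum.
  under eq_bigr => k _.
    rewrite map_polyZ rmorphD /= !map_polyXn hornerZ !hornerE.
    have -> : z ^+ (d + k.+1) + z ^+ (d - k.+1) = z ^+ d * (theta R (2 ^ m.+2) k.+1)%:C.
      by rewrite -zetaDV mulrDr exprD exprB ?unitfE // ltnW.
    rewrite ratr_int mulrCA.
    over.
  rewrite map_polyZ /= map_polyXn hornerZ !hornerE -mulr_sumr.
  have -> : \sum_(k < d.-1) (c k)%:~R * (theta R (2 ^ m.+2) k.+1)%:C =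
      (2 * l%:~R : R)%:C.
    rewrite -rel rmorph_sum; apply: eq_bigr => k _.
    by rewrite [RHS]rmorphM rmorph_int.
  by rewrite !rmorphM !rmorph_nat !rmorph_int /= [X in _ - X]mulrC subrr.
have := congr1 (fun p : {poly rat} => p`_(d + i.+1)) (root_small_eq0 zN1 sizeP Pz).
rewrite /P coefB coef_sum coefZ coefXn coef0.
have -> : (d + i.+1 == d)%N = false by rewrite -[X in _ == X]addn0 eqn_add2l.
rewrite mulr0 subr0.
have lt_exp k : (d - k < d + i.+1)%N.
  by rewrite (leq_ltn_trans (leq_subr _ _)) // -addSnnS ltn_addr.
rewrite (bigD1 i) //= big1 => [|k ki].
  rewrite coefZ coefD !coefXn eqxx (gtn_eqF (lt_exp _)).
  by rewrite !addr0 mulr1 => /eqP; rewrite intr_eq0 => /eqP.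
rewrite coefZ coefD !coefXn eqn_add2l eqSS (gtn_eqF (lt_exp _)).
by rewrite (inj_eq val_inj) eq_sym (negPf ki) addr0 mulr0.
Qed.

Lemma theta_reflect (R : realType) (d j : nat) : (0 < d)%N -> (j <= 2 * d)%N ->
  theta R (4 * d) (2 * d - j) = - theta R (4 * d) j.
Proof.
move=> d0 jd; rewrite /theta mulrnBr // cosB.
have -> : pi *+ 2 / (4 * d)%:R *+ (2 * d) = pi :> R.
  rewrite -mulr_natr -mulr_natl !natrM.
  field. by rewrite pnatr_eq0 -lt0n d0.
by rewrite cospi sinpi mul0r addr0 mulN1r mulrN.
Qed.

(** Going from j to 2 d - j negates the eigenvalue and so inverts the phase, but a limit equal to 1
    or -1 is its own inverse; going from j to 4 d - j changes nothing. Parities match in both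
    cases. *)
Lemma pgst_cycle_extend (R : realType) (d : nat) (t : nat -> R) : (0 < d)%N ->
  (forall j, (j < d)%N -> (fun k => cis (- (t k * theta R (4 * d) j))) @ \oo -->
    ((-1) ^+ (d + j) : Cplx R)) ->
  forall j, (fun k => cis (- (t k * theta R (4 * d) j))) @ \oo -->
    ((-1) ^+ (d + j) : Cplx R).
Proof.
move=> d0 H.
have H1 j : (j <= d)%N -> (fun k => cis (- (t k * theta R (4 * d) j))) @ \oo -->
    ((-1) ^+ (d + j) : Cplx R).
  rewrite leq_eqVlt => /predU1P[->|]; last exact: H.
  (* The index d is fixed by the reflection that negates [theta]. *)
  have theta_d : theta R (4 * d) d = 0.
    have := @theta_reflect R d d d0; rewrite leq_pmull // => /(_ isT).
    rewrite mul2n -addnn addnK => /eqP; rewrite -addr_eq0 -mulr2n mulrn_eq0.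
    by move=> /eqP.
  rewrite addnn -mul2n exprM sqrrN !expr1n theta_d.
  under eq_fun => k do rewrite mulr0 oppr0 cis0.
  exact: cvg_cst.
have H2 j : (j <= 2 * d)%N -> (fun k => cis (- (t k * theta R (4 * d) j))) @ \oo -->
    ((-1) ^+ (d + j) : Cplx R).
  move=> j2; have [|dj] := leqP j d; first exact: H1.
  have /H1 : (2 * d - j <= d)%N by rewrite leq_subLR mul2n -addnn leq_add2r ltnW.
  rewrite (theta_reflect R d0 j2).
  have -> : (-1) ^+ (d + (2 * d - j)) = ((-1) ^+ (d + j))^-1 :> Cplx R.
    by rewrite -exprVn invrN1 -signr_odd oddD oddB // oddM /= -oddD signr_odd.
  have s0 : (-1) ^+ (d + j) != 0 :> Cplx R by rewrite signr_eq0.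
  move=> /(cvgV (invr_neq0 s0)); rewrite invrK.
  apply: cvg_trans; apply: near_eq_cvg; near=> k.
  by rewrite /= -cisN mulrN !opprK.
have n3 : (2 < 4 * d)%N by rewrite (@leq_trans (4 * 1)) // leq_mul2l.
move=> j; rewrite -(theta_mod R n3) -signr_odd oddD.
have -> : odd j = odd (j %% (4 * d)) by rewrite odd_mod // oddM.
rewrite -oddD signr_odd.
have: (j %% (4 * d) < 4 * d)%N by rewrite ltn_mod (ltn_trans _ n3).
move: (j %% _)%N => {}j j4; have [|dj] := leqP j (2 * d); first exact: H2.
have /H2 : (4 * d - j <= 2 * d)%N.
  by rewrite leq_subLR (leq_trans _ (leq_add (ltnW dj) (leqnn _))) // -mulnDl.
rewrite (thetaN R n3 (ltnW j4)).
have -> : (-1) ^+ (d + (4 * d - j)) = (-1) ^+ (d + j) :> Cplx R; last by [].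
by rewrite -signr_odd oddD oddB ?(ltnW j4) // oddM /= -oddD signr_odd.
Unshelve. all: by end_near. Qed.

(** Equal products mean that pi times an integer combination of the [theta] lies in 2 pi Z;
    cancelling pi leaves the relation excluded by [theta_indep]. *)
Lemma cis_theta_indep (R : realType) (m : nat)
    (a b : {ffun 'I_(2 ^ m).-1 -> nat}) :
  \prod_(i < (2 ^ m).-1) cis (- (pi * theta R (2 ^ m.+2) i.+1)) ^+ a i =
  \prod_(i < (2 ^ m).-1) cis (- (pi * theta R (2 ^ m.+2) i.+1)) ^+ b i -> a = b.
Proof.
pose th (i : 'I_(2 ^ m).-1) := theta R (2 ^ m.+2) i.+1.
have prodE (e : {ffun 'I_(2 ^ m).-1 -> nat}) :
  \prod_(i < (2 ^ m).-1) cis (- (pi * theta R (2 ^ m.+2) i.+1)) ^+ e i =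
  cis (- (pi * \sum_i (e i)%:R * th i)).
  rewrite mulr_sumr -sumrN cis_sum; apply: eq_bigr => i _.
  by rewrite -cisX mulNrn [pi * (_%:R * _)]mulrCA mulr_natl.
rewrite !prodE => eab.
have /cis_eq1[l] : cis (pi * \sum_i ((a i)%:Z - (b i)%:Z)%:~R * th i) = 1.
  under eq_bigr do rewrite intrD rmorphN mulrDl mulNr.
  rewrite sumrB mulrBr cisD.
  have -> : cis (pi * \sum_i (a i)%:~R * th i) =
      (cis (- (pi * \sum_i (b i)%:R * th i)))^-1.
    by rewrite -eab -cisN opprK.
  by rewrite mulVf // -normr_gt0 norm_cis.
rewrite -mulr_natr -mulrA => /mulfI rel.
apply/ffunP => i; apply/eqP; rewrite -eqz_nat -subr_eq0; apply/eqP.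
apply: (@theta_indep R m (fun i => (a i)%:Z - (b i)%:Z) l).
by apply: rel; rewrite gt_eqF // pi_gt0.
Qed.

Lemma pow2_pgst_cycle (R : realType) (m : nat) (n_ge3 : (2 < 2 ^ m.+2)%N) :
  pgst R (cycle_graph n_ge3).
Proof.
set d := (2 ^ m)%N; have d0 : (0 < d)%N by rewrite expn_gt0.
have nE : (2 ^ m.+2 = 4 * d)%N by rewrite !expnS mulnA.
have [t Ht] : exists t : nat -> R, forall j, (j < d)%N ->
    (fun k => cis (- (t k * theta R (4 * d) j))) @ \oo -->
    ((-1) ^+ (d + j) : Cplx R).
  have theta0 : theta R (4 * d) 0 = 2 by rewrite /theta mulr0n cos0 mulr1.
  have [d1|d1] := leqP d 1.
    have {}d1 : d = 1%N by apply/eqP; rewrite eqn_leq d1.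
    (* For the 4-cycle only j = 0 is left, and the constant time pi / 2 gives the phase cis (- pi) =
       -1 exactly. *)
    exists (fun=> pi / 2) => j; rewrite {1}d1 ltnS leqn0 => /eqP ->.
    rewrite theta0 divfK // cisN cis_pi d1 expr1 invrN1; exact: cvg_cst.
  have d_even : odd d = false.
    by move: d1; rewrite /d; case: (m) => // m' _; rewrite expnS oddM.
  have [s Hs] := @kronecker_cvg R _
    (fun i : 'I_d.-1 => cis (- (pi * theta R (2 ^ m.+2) i.+1)))
    (fun i => (-1) ^+ i.+1) (fun i => norm_cis _)
    (fun i => normr_sign _ _) (@cis_theta_indep R m).
  (* Times in pi N keep the phase of [theta 0] = 2 equal to 1, which is (-1)^d as d is even. *)
  exists (fun k => pi * (s k)%:R) => [[|j]] jd.
    rewrite theta0 addn0 -signr_odd d_even expr0.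
    have c1 k : cis (- (pi * (s k)%:R * 2)) = 1 :> Cplx R.
      have -> : pi * (s k)%:R * 2 = pi *+ 2 *+ s k :> R.
        by rewrite -[RHS]mulr_natr -[pi *+ 2]mulr_natr mulrAC.
      by rewrite cisN cisX cis_2pi expr1n invr1.
    under eq_fun => k do rewrite c1.
    exact: cvg_cst.
  have jd' : (j < d.-1)%N by rewrite -ltnS prednK.
  have -> : (-1) ^+ (d + j.+1) = (-1) ^+ j.+1 :> Cplx R.
    by rewrite -signr_odd oddD d_even addFb signr_odd.
  have := Hs (Ordinal jd').
  under eq_fun => k do rewrite -cisX mulNrn -[_ *+ s k]mulr_natr [_ * (s k)%:R]mulrAC nE.
  exact.
apply/pgst_cycleP.
(* Transfer is between antipodal vertices: zeta^(2 d) = -1 produces the alternating signs in j. *)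
exists (2 * d)%:R, t, ((-1) ^+ d).
have n1 : (1 < 2 ^ m.+2)%N by rewrite ltnW.
have w2 : ((2 * d)%:R : 'Z_(2 ^ m.+2)) = (2 * d)%N :> nat.
  by rewrite (val_Zp_nat n1) modn_small // nE ltn_mul2r d0.
have zw : zeta R (2 ^ m.+2) ^+ (2 * d) = -1 by rewrite -expnS; exact: zeta_half.
split=> [||j].
- by apply/eqP => /(congr1 (@nat_of_ord _)); rewrite w2; case: (d) d0.
- by rewrite normrX normrN1 expr1n.
rewrite w2 exprM zw -exprD nE; exact: pgst_cycle_extend.
Qed.

Theorem theorem2p7 (R : realType) (n : nat) (n_ge3 : (3 <= n)%N) :
  pgst R (cycle_graph n_ge3) <-> exists k : nat, (2 <= k)%N /\ n = (2 ^ k)%N.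
Proof.
split=> [/pgst_cycle_pow2 //|[[|[|m]] [// _ nE]]].
by subst n; exact: pow2_pgst_cycle.
Qed.
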